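(* Let $r\ge 1$ be an integer and let $G$ and $H$ be finite simple graphs such that $G \xrightarrow{r} H$. Then there is a constant $c=c(G,H,r)$ such that for every positive integer $t$, $G[c^t]$ is canonically $r$-Ramsey for $H[t]$.
   Context: All graphs are finite and simple. We write $G \xrightarrow{r} H$ if every colouring of the edges of $G$ with $r$ colours contains a monochromatic copy of $H$. For a graph $G$ with vertices $v_1,\dots,v_m$ and a positive integer $n$, the $n$-blowup $G[n]$ is obtained by replacing each vertex $v_i$ by an independent set $U_i$ of $n$ vertices (its vertex class) and, for every edge $v_iv_j$ of $G$, putting a complete bipartite graph between $U_i$ and $U_j$. A copy of $H[t]$ in $G[n]$ is called canonical if it is the $t$-blowup of a copy of $H$ in $G$: i.e. there is a copy $H'$ of $H$ in $G$ and, for each vertex $v_i$ of $H'$, a set $S_i\subseteq U_i$ with $|S_i|=t$, and the copy consists of the vertices $\bigcup S_i$ and all edges of $G[n]$ between $S_i$ and $S_j$ for each edge $v_iv_j$ of $H'$. We say $G[n]$ is canonically $r$-Ramsey for $H[t]$ if every $r$-colouring of the edges of $G[n]$ contains a canonical copy of $H[t]$ all of whose edges have the same colour. For non-integer $x$, $G[x]$ means $G[\lceil x\rceil]$. *)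

(* Defs.v *)
From HB Require Import structures.
From mathcomp Require Import all_boot all_order all_algebra.
From mathcomp Require Import reals.

Set Implicit Arguments.
Unset Strict Implicit.
Unset Printing Implicit Defensive.

Record sgraph := SGraph {
  vertex :> finType;
  adj : rel vertex;
  adj_sym : symmetric adj;
  adj_irr : irreflexive adj }.

Definition edges (G : sgraph) : {set {set G}} :=
  [set [set p.1; p.2] | p : G * G & adj p.1 p.2].

Definition edge_colouring (r : nat) (G : sgraph) : Type :=
  {e : {set G} | e \in edges G} -> 'I_r.

Definition monochromatic (r : nat) (G : sgraph) (chi : edge_colouring r G)
    (F : {set {set G}}) : Prop :=
  exists k : 'I_r, forall e, val e \in F -> chi e = k.

(* A copy of H in G (a not necessarily induced subgraph of G isomorphic to H)
   is presented by an injective map preserving adjacency; its edge set is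
   [copy_edges f]. *)
Definition is_copy (H G : sgraph) (f : H -> G) : Prop :=
  injective f /\ forall x y : H, adj x y -> adj (f x) (f y).

Definition copy_edges (H G : sgraph) (f : H -> G) : {set {set G}} :=
  [set f @: (e : {set H}) | e : {set H} in edges H].

Definition ramsey (r : nat) (G H : sgraph) : Prop :=
  forall chi : edge_colouring r G,
    exists f : H -> G, is_copy f /\ monochromatic chi (copy_edges f).

Definition blowup_adj (G : sgraph) (n : nat) : rel (G * 'I_n)%type :=
  fun u v => adj u.1 v.1.

Lemma blowup_adj_sym (G : sgraph) (n : nat) : symmetric (@blowup_adj G n).
Proof. by move=> u v; apply: adj_sym. Qed.

Lemma blowup_adj_irr (G : sgraph) (n : nat) : irreflexive (@blowup_adj G n).
Proof. by move=> u; apply: adj_irr. Qed.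

Definition blowup (G : sgraph) (n : nat) : sgraph :=
  SGraph (@blowup_adj_sym G n) (@blowup_adj_irr G n).

Definition vclass (G : sgraph) (n : nat) (v : G) : {set blowup G n} :=
  [set u : G * 'I_n | u.1 == v].

(* The canonical copy of H[t] over the copy of H given by f has vertex set
   the union of the sets S x; S is indexed by the vertices x of H rather than
   by the vertices f x of the copy, which is harmless as f is injective. *)
Definition is_canonical (G H : sgraph) (n t : nat) (f : H -> G)
    (S : H -> {set blowup G n}) : Prop :=
  is_copy f /\ forall x : H, S x \subset vclass n (f x) /\ #|S x| = t.

Definition canonical_edges (G H : sgraph) (n : nat)
    (S : H -> {set blowup G n}) : {set {set blowup G n}} :=
  [set e in edges (blowup G n) |
    [exists x : H, exists y : H, adj x y &&
      [exists u in S x, exists v in S y, e == [set u; v]]]].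

Definition canonically_ramsey (r : nat) (G : sgraph) (n : nat)
    (H : sgraph) (t : nat) : Prop :=
  forall chi : edge_colouring r (blowup G n),
    exists (f : H -> G) (S : H -> {set blowup G n}),
      is_canonical t f S /\ monochromatic chi (canonical_edges S).

(* The ceiling as a natural number; absz is the identity on the ceilings of
   nonnegative reals, the only ones of interest. *)
Definition nceil (R : realType) (x : R) : nat := `|Num.ceil x|%N.

(* Main.v *)
(** Choosing one vertex in each class of [G[n]] gives a transversal copy of [G],
    hence a monochromatic copy of [H]; by pigeonhole some fixed copy [f] of [H]
    and colour [k] work for a positive proportion of the transversals.  It then
    suffices that a dense set [M] of [h]-tuples over an [n]-set, with [n]
    exponential in [t], contains [t] tuples, pairwise distinct in every
    coordinate, such that any two of their entries in different coordinates
    appear together in some member of [M].  The last statement goes by induction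
    on [h] (in the style of Nikiforov): apply it to the tails having many
    extensions and [4dt] in place of [t]; the resulting tails have so many
    extensions that some [t] of them share [t] common ones. *)
Require Import Defs.
From HB Require Import structures.
From mathcomp Require Import all_boot all_order all_algebra.
From mathcomp Require Import boolp reals.
From mathcomp Require Import zify.

Set Implicit Arguments.
Unset Strict Implicit.
Unset Printing Implicit Defensive.

Import GRing.Theory Num.Theory.

(** The fibres of [P] over [U] may overlap, but they cover [A], so a largest one will do; [u0] makes
    a maximum exist even when [A] is empty. *)
Lemma pigeonhole (T U : finType) (A : {set T}) (P : T -> U -> bool) (u0 : U) :
  (forall x, x \in A -> exists u, P x u) ->
  exists u, #|A| <= #|U| * #|[set x in A | P x u]|.
Proof.
move=> hP; pose F u := #|[set x in A | P x u]|.
have [u _ umax] := @arg_maxnP U u0 xpredT F isT.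
exists u; apply: (@leq_trans (\sum_(v : U) F v)); last first.
  by rewrite -sum_nat_const; apply: leq_sum => v _; apply: umax.
have -> : \sum_(v : U) F v = \sum_(x in A) \sum_(v : U) P x v.
  rewrite exchange_big /=; apply: eq_bigr => v _.
  by rewrite /F -sum1dep_card big_mkcondr /=; apply: eq_bigr => x _; case: (P x v).
rewrite -sum1_card; apply: leq_sum => x /hP[v Pv].
by rewrite (bigD1 v) //= Pv.
Qed.

Lemma leq_sum_threshold (I : finType) (f : I -> nat) (a B : nat) :
  (forall i, f i <= B) ->
  \sum_i f i <= B * #|[set i | a <= f i]| + a * #|I|.
Proof.
move=> fB; rewrite (bigID (fun i => a <= f i)) /= leq_add //.
  by rewrite mulnC -sum_nat_cond_const leq_sum // => i _; apply: fB.
rewrite mulnC -sum_nat_const [leqRHS](bigID (fun i => a <= f i)) /=.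
apply: leq_trans (leq_addl _ _); apply: leq_sum => i.
by rewrite -ltnNge => /ltnW.
Qed.

Lemma injection_in_set (T : finType) (A : {set T}) (t : nat) :
  t <= #|A| -> exists2 g : 'I_t -> T, injective g & forall j, g j \in A.
Proof.
move=> tA; exists (fun j => enum_val (widen_ord tA j)) => [j j' /enum_val_inj|j].
  by move/(congr1 val) => /= /val_inj.
exact: enum_valP.
Qed.

Lemma card_tuple_cons (T : finType) (h : nat) (M : {set h.+1.-tuple T}) :
  #|M| = \sum_(s : h.-tuple T) #|[set x | [tuple of x :: s] \in M]|.
Proof.
rewrite -sum1_card.
rewrite [RHS](eq_bigr (fun s : h.-tuple T => \sum_(x | [tuple of x :: s] \in M) 1));
  last by move=> s _; rewrite sum1dep_card.
rewrite pair_big_dep /=.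
rewrite (reindex (fun p : h.-tuple T * T => [tuple of p.2 :: p.1])) //=.
exists (fun s : h.+1.-tuple T => ([tuple of behead s], thead s)) => [[s x] _|s _] /=.
  by congr pair; apply: val_inj.
by rewrite [RHS]tuple_eta; apply: val_inj.
Qed.

(** Tails below the threshold account for at most [#|T| ^ h.+1 / (2 * d)] members of [M], half of
    the guaranteed number; each other tail accounts for at most [#|T|]. *)
Lemma dense_extensions (T : finType) (h d : nat) (M : {set h.+1.-tuple T}) :
  0 < #|T| -> #|T| ^ h.+1 <= d * #|M| ->
  #|T| ^ h <=
    2 * d * #|[set s : h.-tuple T |
                #|T| <= 2 * d * #|[set x | [tuple of x :: s] \in M]| ]|.
Proof.
move=> T0 hM.
have /= := @leq_sum_threshold _
  (fun s : h.-tuple T => 2 * d * #|[set x | [tuple of x :: s] \in M]|)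
  #|T| (2 * d * #|T|) (fun s => leq_mul (leqnn _) (max_card _)).
rewrite -big_distrr /= -card_tuple_cons card_tuple -expnS => le1.
rewrite -(leq_pmul2l T0) -expnS.
rewrite -(leq_add2r (#|T| ^ h.+1)) addnn -mul2n; apply: leq_trans (leq_mul (leqnn 2) hM) _.
by rewrite mulnA (leq_trans le1) // leq_add2r mulnA [#|T| * _]mulnC.
Qed.

(** Double counting gives [E x] average size at least [2 * t], so at least [#|T| / (4 * d)] points
    have [t <= #|E x|]. Pigeonhole over the [2 ^ (4 * d * t)] possible values of [E x] then finds
    one taken [t] times. *)
Lemma popular_subset (T : finType) (d t : nat) (E : T -> {set 'I_(4 * d * t)}) :
  0 < d -> 0 < t -> 4 * d * 2 ^ (4 * d * t) * t <= #|T| ->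
  (forall j, #|T| <= 2 * d * #|[set x | j \in E x]|) ->
  exists (J : {set 'I_(4 * d * t)}) (W : {set T}),
    [/\ t <= #|J|, t <= #|W| & forall x, x \in W -> E x = J].
Proof.
move=> d0 t0 hT hE; set s := 4 * d * t in E hT hE *.
pose X := [set x | t <= #|E x|].
have sumE : \sum_x #|E x| = \sum_(j < s) #|[set x | j \in E x]|.
  under eq_bigr do rewrite -sum1_card big_mkcond.
  rewrite exchange_big /=; apply: eq_bigr => j _.
  by rewrite -sum1dep_card [RHS]big_mkcond.
have le1 : s * #|T| <= 2 * d * \sum_x #|E x|.
  rewrite sumE big_distrr /= -[s in s * _]card_ord -sum_nat_const.
  by apply: leq_sum => j _; apply: hE.
have le2 : \sum_x #|E x| <= s * #|X| + t * #|T|.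
  by apply: leq_sum_threshold => x; rewrite -[s in _ <= s]card_ord max_card.
have le3 : #|T| <= 4 * d * #|X|.
  rewrite -(leq_pmul2l t0) -(@leq_pmul2l (2 * d)); last by lia.
  by move: le1 le2; rewrite /s; nia.
have [J hJ] := @pigeonhole _ _ X (fun x u => E x == u) set0
                 (fun x _ => ex_intro _ (E x) (eqxx _)).
rewrite -cardsT -powersetT card_powerset cardsT card_ord in hJ.
have tW : t <= #|[set x in X | E x == J]|.
  rewrite -(@leq_pmul2l (4 * d * 2 ^ s)); last by rewrite muln_gt0 expn_gt0; lia.
  apply: leq_trans hT (leq_trans le3 _).
  by rewrite -[leqRHS]mulnA leq_mul2l hJ orbT.
exists J, [set x in X | E x == J]; split=> // [|x]; last first.
  by rewrite inE => /andP[_ /eqP].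
(* [J] is large because it equals [E x] for some [x] in [X]. *)
have /card_gt0P[x] := leq_trans t0 tW.
by rewrite !inE => /andP[tx /eqP <-].
Qed.


Lemma diagonal_blowup (h d : nat) : 0 < d ->
  exists2 C, 0 < C & forall (t : nat) (T : finType) (M : {set h.-tuple T}),
    0 < t -> C ^ t <= #|T| -> #|T| ^ h <= d * #|M| ->
    exists a : 'I_t -> h.-tuple T,
      [/\ forall j, a j \in M,
          forall i, injective (fun j => tnth (a j) i) &
          forall i i' j j', i != i' ->
            exists2 b, b \in M & tnth b i = tnth (a j) i /\
                                 tnth b i' = tnth (a j') i'].
Proof.
elim: h d => [|h IH] d d0.
  exists 1 => // t T M t0 _; rewrite expn0 muln_gt0 d0 /= => /card_gt0P[a aM].
  by exists (fun=> a); split=> // -[].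
have [|C C0 hC] := IH (2 * d); first by rewrite muln_gt0.
(* The first factor serves the induction hypothesis at [4 * d * t]; the second serves
   [popular_subset], as [(8 * d) ^ t] is at least [4 * d * t]. *)
exists (C ^ (4 * d) * (8 * d * 2 ^ (4 * d))).
  by rewrite !muln_gt0 !expn_gt0 C0 d0.
move=> t T M t0; rewrite expnMn => hT hM.
have hT1 : C ^ (4 * d * t) <= #|T|.
  rewrite expnM; apply: leq_trans hT; apply: leq_pmulr.
  by rewrite expn_gt0 !muln_gt0 expn_gt0 d0.
have hT2 : 4 * d * 2 ^ (4 * d * t) * t <= #|T|.
  apply: leq_trans hT; apply: leq_trans (leq_pmull _ _); last first.
    by rewrite !expn_gt0 C0.
  rewrite expnMn -expnM (_ : 8 * d = 4 * d * 2); last by lia.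
  rewrite expnMn mulnAC leq_mul2r; apply/orP; right.
  apply: leq_mul; last by rewrite ltnW // ltn_expl.
  by rewrite -[leqLHS]expn1 leq_pexp2l // muln_gt0.
have T0 : 0 < #|T| by apply: leq_trans hT1; rewrite expn_gt0 C0.
have [|a [aM' ainj acov]] := hC (4 * d * t) T _ _ hT1 (dense_extensions T0 hM).
  by rewrite !muln_gt0 d0.
pose E x := [set j | [tuple of x :: a j] \in M].
have hE j : #|T| <= 2 * d * #|[set x | j \in E x]|.
  have := aM' j; rewrite inE => /leq_trans; apply.
  by rewrite leq_mul2l subset_leq_card ?orbT //; apply/subsetP => x; rewrite !inE.
have [J [W [tJ tW WJ]]] := popular_subset d0 t0 hT2 hE.
have [g ginj gJ] := injection_in_set tJ.
have [w winj wW] := injection_in_set tW.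
(* Every chosen head extends every chosen tail, which settles all pairs involving coordinate 0. *)
have wgM j j' : [tuple of w j :: a (g j')] \in M.
  by have := gJ j'; rewrite -(WJ _ (wW j)) inE.
exists (fun j => [tuple of w j :: a (g j)]); split=> [j|i|i i' j j'].
- exact: wgM.
- case: (unliftP ord0 i) => [i0|] -> j j'; rewrite ?tnthS ?tnth0.
    by move/ainj/ginj.
  exact: winj.
- case: (unliftP ord0 i) => [i0|] ->; case: (unliftP ord0 i') => [i0'|] ->;
    rewrite ?tnthS ?tnth0 ?eqxx // => ii'.
  (* Here [b] is only a tail with many extensions; any one of them completes it to a member of
     [M]. *)
  + have [|b] := acov i0 i0' (g j) (g j').
      by apply: contraNneq ii' => ->.
    rewrite inE => bM [b1 b2].
    have /card_gt0P[x] : 0 < #|[set x | [tuple of x :: b] \in M]|.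
      by move: (leq_trans T0 bM); rewrite muln_gt0 => /andP[].
    by rewrite inE => xbM; exists [tuple of x :: b]; rewrite // !tnthS.
  + by exists [tuple of w j' :: a (g j)]; rewrite // !tnthS tnth0.
  + by exists [tuple of w j :: a (g j')]; rewrite // !tnthS tnth0.
Qed.

Definition transversal (G : sgraph) (n : nat) (s : #|G|.-tuple 'I_n) (v : G) : blowup G n :=
  (v, tnth s (enum_rank v)).

Lemma adj_edges (K : sgraph) (u v : K) : adj u v -> [set u; v] \in edges K.
Proof. by move=> uv; apply/imsetP; exists (u, v); rewrite ?inE. Qed.

Lemma transversal_edge (G : sgraph) (n : nat) (s : #|G|.-tuple 'I_n) (e : {set G}) :
  e \in edges G -> transversal s @: e \in edges (blowup G n).
Proof.
case/imsetP=> -[u v]; rewrite inE /= => uv ->; rewrite imsetU !imset_set1.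
exact: (@adj_edges (blowup G n)).
Qed.

(** Pull [chi] back to [G] along the transversal. Quantifying over [e] with a given value avoids
    carrying membership proofs in the conclusion. *)
Lemma ramsey_transversal (r n : nat) (G H : sgraph)
    (chi : edge_colouring r (blowup G n)) (s : #|G|.-tuple 'I_n) :
  ramsey r G H ->
  exists (f : H -> G) (k : 'I_r), is_copy f /\
    forall x y, adj x y ->
    forall e, val e = [set transversal s (f x); transversal s (f y)] -> chi e = k.
Proof.
move=> /(_ (fun e => chi (exist (fun e => e \in edges (blowup G n)) _ (transversal_edge s (svalP e))))).
case=> f [fcopy [k hk]]; exists f, k; split=> // x y xy e he.
have fe : [set f x; f y] \in edges G by apply/adj_edges/fcopy.2.
rewrite -(hk (exist (fun e => e \in edges G) _ fe)) /=.
  congr chi; apply: val_inj => /=.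
  by rewrite he imsetU !imset_set1.
by apply/imsetP; exists [set x; y]; rewrite ?adj_edges // imsetU !imset_set1.
Qed.

Lemma canonically_ramsey_exp (r : nat) (G H : sgraph) :
  ramsey r G H ->
  exists2 C, 0 < C & forall t, 0 < t -> canonically_ramsey r G (C ^ t) H t.
Proof.
(* The number of pairs of a map and a colour, plus one to be visibly positive. *)
move=> GH; pose d := #|{: {ffun H -> G} * 'I_r}|.+1.
have [C C0 hC] := @diagonal_blowup #|G| d isT.
exists C => // t t0 chi; set n := C ^ t in chi *.
pose good s (p : {ffun H -> G} * 'I_r) := `[< is_copy p.1 /\
    forall x y, adj x y -> forall e,
      val e = [set transversal s (p.1 x); transversal s (p.1 y)] -> chi e = p.2 >].
have ex_good s : exists p, good s p.
  have [f [k [[finj fadj] hk]]] := ramsey_transversal chi s GH.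
  exists (finfun f, k); apply/asboolP; split; first split.
  - by move=> x y; rewrite !ffunE; apply: finj.
  - by move=> x y; rewrite !ffunE; apply: fadj.
  - by move=> x y xy e /=; rewrite !ffunE; apply: hk.
have n0 : 0 < n by rewrite expn_gt0 C0.
have [p0 _] := ex_good [tuple of nseq #|G| (Ordinal n0)].
have [[f k] hM] := @pigeonhole _ _ setT good p0 (fun s _ => ex_good s).
set M := [set x in _ | _] in hM.
have goodM s : s \in M -> good s (f, k) by rewrite !inE.
have [//|||a [aM ainj acov]] := hC t 'I_n M.
- by rewrite card_ord.
- rewrite cardsT card_tuple in hM; apply: leq_trans hM _.
  by rewrite leq_mul2r leqnSn orbT.
pose j0 := Ordinal t0.
have [fcopy _] := asboolW (goodM _ (aM j0)).
exists f, (fun x => [set transversal (a j) (f x) | j : 'I_t]); split.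
  split=> // x; split.
    by apply/subsetP => _ /imsetP[j _ ->]; rewrite inE.
  by rewrite card_imset ?card_ord // => j j' [] /ainj.
exists k => e; rewrite inE => /andP[_ /existsP[x /existsP[y /andP[xy]]]].
case/existsP=> _ /andP[/imsetP[j _ ->]] /existsP[_ /andP[/imsetP[j' _ ->]]] /eqP eE.
(* The two ends of the edge lie on a common transversal [b] in [M], whose copy along [f] has colour
   [k]. *)
have [|b bM [bx by_]] := acov (enum_rank (f x)) (enum_rank (f y)) j j'.
  by apply: contraTneq xy => /enum_rank_inj/fcopy.1 ->; rewrite adj_irr.
have [_ /(_ x y xy e)] := asboolW (goodM _ bM); apply.
by rewrite eE /transversal bx by_.
Qed.

Local Open Scope ring_scope.

Theorem theorem1p1 (R : realType) (r : nat) (G H : sgraph) :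
  (1 <= r)%N -> ramsey r G H ->
  exists c : R, 0 < c /\
    forall t : nat, (1 <= t)%N ->
      canonically_ramsey r G (nceil (c ^+ t)) H t.
Proof.
move=> _ /canonically_ramsey_exp[C C0 hC].
exists C%:R; split=> [|t t0]; first by rewrite ltr0n.
(* The constant is a natural number, so the ceiling changes nothing. *)
have -> : nceil (C%:R ^+ t : R) = (C ^ t)%N.
  by rewrite /nceil -natrX -[(C ^ t)%:R]/((C ^ t)%:Z%:~R) intrKceil.
exact: hC.
Qed.
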